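(* Let the edge passage times $X_e$ be i.i.d. positive random variables with an arbitrary common distribution, and let $W_n$ be the largest passage time among all self-avoiding paths from $1$ to $n$ in the complete graph $G_n$. Then there exists a constant $\mu$ with $0<\mu\le\infty$ such that $$\frac{W_n}{n}\to\mu\quad\text{almost surely as } n\to\infty .$$ If $\mu<\infty$, then this convergence also holds in $L_1$. Furthermore, $\mu$ is the essential supremum of $X_e$, i.e. $$\mu=\inf\{x:\mathbb{P}(X_e>x)=0\},$$ with the convention $\inf\emptyset=\infty$.
   Context: Last passage percolation on the complete graph. $G_n=([n],E_n)$ is the complete graph on $[n]=\{1,\dots,n\}$, with $E_n=\{\langle i,j\rangle:1\le i<j\le n\}$. Each edge $e$ carries a positive random passage time $X_e$, and the passage times are independent and identically distributed. All $n$ are treated on one probability space: there is a single i.i.d. family $\{X_{\langle i,j\rangle}:1\le i<j<\infty\}$, and $G_n$ uses the variables with $j\le n$. For $n\ge2$, $\Pi_{1,n}$ is the set of all self-avoiding paths in $G_n$ from vertex $1$ to vertex $n$ (no repeated vertices). The passage time of a path $\pi$ is $T(\pi)=\sum_{e\in\pi}X_e$, and $W_n=\sup_{\pi\in\Pi_{1,n}}T(\pi)$. *)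

(* Defs.v *)
From HB Require Import structures.
From mathcomp Require Import all_boot all_order all_algebra.
From mathcomp Require Import finmap.
From mathcomp Require Import all_classical all_reals all_analysis.

Set Implicit Arguments.
Unset Strict Implicit.
Unset Printing Implicit Defensive.

Import Order.TTheory GRing.Theory Num.Theory.
Import numFieldNormedType.Exports.

Local Open Scope classical_set_scope.
Local Open Scope ring_scope.

(* Vertices are the natural numbers 1, 2, 3, ..., and the edge <i, j>, i < j,
   is the ordered pair (i, j). *)
Definition is_edge (e : nat * nat) : bool := (0 < e.1 < e.2)%N.

Definition edge (u v : nat) : nat * nat := (minn u v, maxn u v).

Definition complete_graph (n : nat) : rel nat :=
  fun u v => [&& (1 <= u <= n)%N, (1 <= v <= n)%N & u != v].

(* A path is the list of all its vertices, both endpoints included; the default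
   value 0 of head and last is not a vertex. *)
Definition self_avoiding_path (n : nat) : set (seq nat) :=
  [set p | [/\ head 0%N p = 1%N, last 0%N p = n,
               sorted (complete_graph n) p & uniq p]].

Definition path_edges (p : seq nat) : seq (nat * nat) :=
  [seq edge uv.1 uv.2 | uv <- zip p (behead p)].

Definition passage_time (R : realType) (x : nat * nat -> R) (p : seq nat) : R :=
  \sum_(e <- path_edges p) x e.

(* The supremum of a nonempty finite set as soon as 1 <= n; the value at n = 0
   is sup set0 = 0. *)
Definition last_passage_time (R : realType) (x : nat * nat -> R) (n : nat) : R :=
  sup [set passage_time x p | p in self_avoiding_path n].

Section Probability.
Context {d : measure_display} {T : measurableType d} {R : realType}.
Variable P : probability T R.

Definition mutually_independent (I : choiceType) (D : set I)
    (X : I -> {RV P >-> R}) : Prop :=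
  forall (J : {fset I}) (A : I -> set R),
    [set` J] `<=` D ->
    (forall i, i \in J -> measurable (A i)) ->
    P (\bigcap_(i in [set` J]) (X i @^-1` A i)) =
    (\prod_(i <- J) P (X i @^-1` A i))%E.

Definition identically_distributed (I : Type) (D : set I)
    (X : I -> {RV P >-> R}) : Prop :=
  forall (i j : I) (A : set R), D i -> D j -> measurable A ->
    distribution P (X i) A = distribution P (X j) A.

Definition converges_in_L1 (f : nat -> T -> R) (g : T -> R) : Prop :=
  [/\ forall n, f n \in Lfun P 1%E, g \in Lfun P 1%E &
      (fun n => ('N[P]_1 [EFin \o (f n \- g)%R])%E) @ \oo --> 0%E].

End Probability.

(* Main.v *)
(* The upper bound W_n <= mu n is trivial. For the lower bound fix c < mu and
   call an edge good if its passage time exceeds c, which happens with positive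
   probability. By a union bound and the Borel-Cantelli lemma, almost surely,
   for all large n any two disjoint sets of at least n / r vertices are joined
   by a good edge. Stop a depth-first search of the graph of good edges when
   the exhausted vertices are as many as the untouched ones: no good edge joins
   these two sets, so both are smaller than n / r, and the stack of the search
   is a path of good edges missing at most 2 n / r vertices. Connecting its ends
   to 1 and n gives liminf W_n / n >= c (1 - 2 / r) for every r. When mu is
   finite, 0 <= W_n / n <= mu and dominated convergence gives the L1 limit. *)

Require Import Defs.
From mathcomp Require Import all_boot all_order all_algebra.
From mathcomp Require Import finmap zify lra.
From mathcomp Require Import all_classical all_reals all_analysis.
From mathcomp Require Import measurable_realfun ess_sup_inf.

Import Order.TTheory GRing.Theory Num.Theory.
Import numFieldNormedType.Exports.
Local Open Scope classical_set_scope.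
Local Open Scope ring_scope.

Set Implicit Arguments.
Unset Strict Implicit.
Unset Printing Implicit Defensive.

(** * Depth-first search in a finite graph *)

(* The state of a depth-first search after m steps: [S] is the set of exhausted
   vertices and [s] is the stack, top first. Each step either pushes a fresh
   vertex on the stack or moves the top of the stack to [S]. *)
Lemma depth_first_search (V : finType) (e : rel V) (m : nat) :
  (m <= #|V|)%N ->
  exists (S : {set V}) (s : seq V),
    [/\ uniq s && sorted e s, forall x, x \in s -> x \notin S,
        forall a b, a \in S -> b \notin S -> b \notin s -> ~~ e b a &
        (#|S| + #|S| + size s)%N = m].
Proof.
elim: m => [_|m IH mV].
  by exists finset.set0, [::]; split => // [a b|]; rewrite ?inE // cards0.
have [S [s [/andP[us ss] sS noe sz]]] := IH (ltnW mV).
(* With an empty stack, [2 * #|S| = m < #|V|] leaves a vertex outside [S], which restarts the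
   search. *)
case: s => [|u s] /= in us ss sS noe sz *.
  have [v vS] : exists v, v \notin S.
    apply/existsP; rewrite -negb_forall; apply/negP => /forallP allS.
    have : S = finset.setT by apply/setP => x; rewrite inE allS.
    by move=> ST; move: sz mV; rewrite ST cardsT; lia.
  exists S, [:: v]; split => //=; last by lia.
    by move=> x; rewrite inE => /eqP ->.
  by move=> a b aS bS _; exact: noe.
have [/existsP[v /and3P[vS vs evu]]|nov] :=
    boolP [exists v, [&& v \notin S, v \notin u :: s & e v u]].
  exists S, [:: v, u & s]; split.
  - by rewrite cons_uniq vs /= us evu.
  - by move=> x; rewrite inE => /orP[/eqP ->//|/sS].
  - move=> a b aS bS; rewrite inE negb_or => /andP[_]; exact: noe.
  - by rewrite /= -sz; lia.
(* The top [u] has no untouched neighbour, so it may join [S] without breaking the no-edge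
   invariant. The count [#|S| + #|S| + size s] gains two and loses one, hence grows by one, as it
   does after a push. *)
have uS : u \notin S by apply: sS; rewrite mem_head.
have /andP[us' us2] := us.
exists (u |: S)%SET, s; split.
- by rewrite us2 (path_sorted ss).
- move=> x xs; rewrite !inE negb_or sS ?inE ?xs ?orbT// andbT.
  by apply: contraNneq us' => <-.
- move=> a b; rewrite !inE negb_or => /orP[/eqP ->|aS] /andP[bu bS] bs.
    move: nov; rewrite negb_exists => /forallP/(_ b).
    by rewrite bS inE negb_or bu bs.
  by apply: noe => //; rewrite inE negb_or bu.
- by rewrite cardsU1 uS -sz /=; lia.
Qed.

Lemma large_path_or_sparse_pair (V : finType) (e : rel V) :
  exists (A B : {set V}) (s : seq V),
    [/\ uniq s && sorted e s, (A :&: B)%SET = finset.set0, #|A| = #|B|,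
        forall a b, a \in A -> b \in B -> ~~ e a b &
        (#|A| + #|B| + size s)%N = #|V|].
Proof.
(* After #|V| steps there are as many exhausted as untouched vertices. *)
have [S [s [uss sS noe sz]]] := depth_first_search e (leqnn #|V|).
pose T := (~: (S :|: [set x in s]))%SET.
have cs : #|[set x in s]%SET| = size s.
  by rewrite cardsE; apply/card_uniqP; case/andP: uss.
have cT : (#|S| + size s + #|T|)%N = #|V|.
  rewrite -(cardsC (S :|: [set x in s])%SET) cardsU.
  rewrite (_ : (S :&: [set x in s])%SET = finset.set0) ?cards0 ?subn0.
    by rewrite cs.
  apply/setP => x; rewrite !inE; apply/negP => /andP[xS /sS].
  by rewrite xS.
exists T, S, s; split => //; last by lia.
- apply/setP => x.
  by rewrite !inE negb_or; case: (x \in S); rewrite ?andbF.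
- by lia.
- by move=> a b; rewrite !inE negb_or => /andP[aS as_] bS; exact: noe.
Qed.

(** * Deterministic bounds on passage times *)

Section paths.
Variables (R : realType) (x : nat * nat -> R).

Lemma passage_time1 (u : nat) : passage_time x [:: u] = 0.
Proof. by rewrite /passage_time big_nil. Qed.

Lemma passage_time_cons (u v : nat) (p : seq nat) :
  passage_time x [:: u, v & p] = x (edge u v) + passage_time x (v :: p).
Proof. by rewrite /passage_time /path_edges /= big_cons. Qed.

Lemma is_edge_edge (u v : nat) :
  (0 < u)%N -> (0 < v)%N -> u != v -> is_edge (edge u v).
Proof. rewrite /is_edge /edge /=; lia. Qed.

Lemma passage_time_rcons_ge (c : R) (u n : nat) (s : seq nat) :
  path (fun a b => c <= x (edge a b)) u s -> 0 <= x (edge (last u s) n) ->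
  c * (size s)%:R <= passage_time x (rcons (u :: s) n).
Proof.
elim: s u => [|v s IH] u /= => [_ xn|/andP[cuv pvs] xn].
  by rewrite passage_time_cons passage_time1 addr0 mulr0.
by rewrite passage_time_cons -natr1 mulrDr mulr1 addrC lerD//; exact: IH.
Qed.

Lemma mem_path_edges (n : nat) (p : seq nat) (e : nat * nat) :
  sorted (complete_graph n) p -> e \in path_edges p ->
  is_edge e && (e.2 <= n)%N.
Proof.
elim: p => [//|u [//|v p] IH] /=.
rewrite /path_edges /= inE => /andP[guv pvp] /orP[/eqP ->|]; last exact: IH.
by move: guv; rewrite /complete_graph /is_edge /edge /=; lia.
Qed.

Lemma size_self_avoiding_path (n : nat) (p : seq nat) :
  self_avoiding_path n p -> (size p <= n)%N.
Proof.
move=> [hp lp sp up]; rewrite -(size_iota 1 n); apply: uniq_leq_size => //.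
move=> v; rewrite mem_iota.
case: p hp lp sp up => [//|u [|w p]] /= hu ln sp _.
  (* A one-vertex path has no edge to confine its vertex; the endpoint conditions give
     [u = 1 = n]. *)
  by rewrite inE => /eqP ->; lia.
elim: p u w {hu ln} sp v => [|z p IH] u w /=.
  by move=> + v; rewrite !inE /complete_graph => ? /orP[]/eqP ->; lia.
move=> /andP[guw pw] v; rewrite inE => /orP[/eqP ->|]; last exact: (IH w z pw).
by move: guw; rewrite /complete_graph; lia.
Qed.

Lemma passage_time_le (M : R) (n : nat) (p : seq nat) : 0 <= M ->
  (forall e, is_edge e -> (e.2 <= n)%N -> x e <= M) ->
  self_avoiding_path n p -> passage_time x p <= M * n%:R.
Proof.
move=> M0 xM sap; have [_ _ sp _] := sap.
rewrite /passage_time big_seq.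
apply: (@le_trans _ _ (\sum_(e <- path_edges p | e \in path_edges p) M)).
  by apply: ler_sum => e /(mem_path_edges sp)/andP[? ?]; exact: xM.
rewrite -big_seq big_const_seq count_predT iter_addr_0 -(mulr_natr M).
rewrite ler_wpM2l// ler_nat (leq_trans _ (size_self_avoiding_path sap))//.
by rewrite /path_edges size_map size_zip size_behead geq_minl.
Qed.

Lemma passage_time_ge0 (n : nat) (p : seq nat) :
  (forall e, is_edge e -> 0 <= x e) ->
  self_avoiding_path n p -> 0 <= passage_time x p.
Proof.
move=> x0 [_ _ sp _]; rewrite /passage_time big_seq sumr_ge0// => e.
by move=> /(mem_path_edges sp)/andP[/x0].
Qed.

(** Boundedness makes [last_passage_time] a genuine supremum rather than a default value. The sum of
    all [|x (i, j)|] with [i, j <= n] dominates each edge of a path. *)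
Lemma has_ubound_passage_time (n : nat) :
  has_ubound [set passage_time x p | p in self_avoiding_path n].
Proof.
pose M := \sum_(i < n.+1) \sum_(j < n.+1) `|x (i : nat, j : nat)|.
exists (M * n%:R) => _ [p sap <-]; apply: passage_time_le sap.
  by apply: sumr_ge0 => i _; apply: sumr_ge0.
move=> [i j] /=; rewrite /is_edge /= => /andP[i0 ij] jn.
have jn' : (j < n.+1)%N by [].
have in' : (i < n.+1)%N by exact: ltn_trans jn'.
rewrite (le_trans (ler_norm _))// /M (bigD1 (Ordinal in'))//=.
rewrite (bigD1 (Ordinal jn'))//= -addrA lerDl addr_ge0//.
  exact: sumr_ge0.
by apply: sumr_ge0 => k _; apply: sumr_ge0.
Qed.

Lemma self_avoiding_path_nonempty (n : nat) :
  (0 < n)%N -> self_avoiding_path n !=set0.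
Proof.
case: n => [//|[_|n _]]; first by exists [:: 1%N].
by exists [:: 1; n.+2]%N; split => //=; rewrite /complete_graph /=; lia.
Qed.

Lemma self_avoiding_path0 : self_avoiding_path 0 = set0.
Proof.
apply/seteqP; split => // p sap; have := size_self_avoiding_path sap.
by case: p sap => // -[].
Qed.

Lemma last_passage_time0 : last_passage_time x 0 = 0.
Proof. by rewrite /last_passage_time self_avoiding_path0 image_set0 sup0. Qed.

Lemma le_last_passage_time (n : nat) (p : seq nat) :
  self_avoiding_path n p -> passage_time x p <= last_passage_time x n.
Proof.
move=> sap; apply: ub_le_sup; first exact: has_ubound_passage_time.
by exists p.
Qed.

Lemma last_passage_time_ge0 (n : nat) :
  (forall e, is_edge e -> 0 <= x e) -> 0 <= last_passage_time x n.
Proof.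
move=> x0; case: n => [|n]; first by rewrite last_passage_time0.
have [p sap] := self_avoiding_path_nonempty (ltn0Sn n).
exact: le_trans (passage_time_ge0 x0 sap) (le_last_passage_time sap).
Qed.

Lemma last_passage_time_le (M : R) (n : nat) : 0 <= M ->
  (forall e, is_edge e -> x e <= M) -> last_passage_time x n <= M * n%:R.
Proof.
move=> M0 xM; case: n => [|n]; first by rewrite last_passage_time0 mulr0.
apply: ge_sup.
  by apply: image_nonempty; exact: self_avoiding_path_nonempty.
by move=> _ [p sap <-]; apply: passage_time_le sap => // e /xM.
Qed.

(* The index [i : 'I_m] stands for the vertex [i + 2]: the vertices 1 and m + 2
   are only used as the ends of the path. *)
Lemma last_passage_time_ge (c : R) (m k : nat) : 0 <= c ->
  (forall e, is_edge e -> 0 <= x e) ->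
  (forall A B : {set 'I_m}, (A :&: B)%SET = finset.set0 -> (k <= #|A|)%N ->
    (k <= #|B|)%N ->
    exists a b : 'I_m, [/\ a \in A, b \in B & c < x (edge a.+2 b.+2)]) ->
  c * (m%:R - (2 * k)%:R - 1) <= last_passage_time x m.+2.
Proof.
move=> c0 x0 good.
pose g (a b : 'I_m) := c < x (edge a.+2 b.+2).
have [A [B [s [/andP[us ss] AB cAB noe cV]]]] := large_path_or_sparse_pair g.
(* [A] and [B] have equal size, so if one reached [k] both would, and a good edge would join
   them. *)
have Ak : (#|A| < k)%N.
  rewrite ltnNge; apply/negP => kA.
  have [|a [b [aA bB cab]]] := good A B AB kA; first by rewrite -cAB.
  by move: (noe a b aA bB); rewrite /g cab.
have mks : (m <= 2 * k + size s)%N.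
  rewrite -[leqLHS]card_ord -cV leq_add2r -cAB addnn -mul2n leq_mul2l /=.
  exact: ltnW.
pose p := 1%N :: rcons [seq (i : 'I_m).+2 | i <- s] m.+2.
have sap : self_avoiding_path m.+2 p.
  split => //=.
  - by rewrite last_rcons.
  - rewrite rcons_path; apply/andP; split.
      case: s us {ss cV mks p} => [//|i s] us /=; apply/andP; split.
        by rewrite /complete_graph /=; have := ltn_ord i; lia.
      elim: s i us => [//|j s IH] i /= /andP[]; rewrite inE negb_or.
      move=> /andP[ij _] us; rewrite IH// andbT.
      move: ij; rewrite -val_eqE /complete_graph /=.
      by have := ltn_ord i; have := ltn_ord j; lia.
    case/lastP: s {us ss cV mks p} => [|s i].
      by rewrite /complete_graph /=; lia.
    rewrite map_rcons last_rcons.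
    by rewrite /complete_graph; have := ltn_ord i; lia.
  - rewrite mem_rcons rcons_uniq inE /= map_inj_uniq ?us ?andbT; last first.
      by move=> i j [] /val_inj.
    apply/andP; split; first by apply/negP => /mapP[].
    by apply/negP => /mapP[i _ [mi]]; have := ltn_ord i; rewrite -mi ltnn.
apply: le_trans (le_last_passage_time sap).
case: s us ss cV mks @p sap => [|i s] us ss cV mks p sap.
  (* With an empty stack [m <= 2 * k], and the bound to be proved is negative or zero. *)
  rewrite (le_trans _ (passage_time_ge0 x0 sap))// mulr_ge0_le0//.
  have : m%:R <= (2 * k)%:R :> R.
    by rewrite ler_nat (leq_trans mks)// addn0.
  by lra.
rewrite /p /= passage_time_cons.
(* The stack [i :: s] has [size s + 1] vertices but only [size s] good edges, hence the [- 1] in the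
   bound. The two edges at the ends 1 and [m.+2] are only known to be nonnegative. *)
have sz : (m <= 2 * k + size s + 1)%N.
  by apply: leq_trans mks _; rewrite /= addnS addn1.
apply: (@le_trans _ _ (c * (size s)%:R)).
  rewrite ler_wpM2l//.
  have : m%:R <= (2 * k + size s + 1)%:R :> R by rewrite ler_nat.
  by rewrite !natrD; lra.
rewrite -[leLHS]add0r lerD//; first by apply/x0/is_edge_edge.
rewrite -(size_map (fun i : 'I_m => i.+2) s); apply: passage_time_rcons_ge.
  move: ss; rewrite /= path_map; apply: sub_path => a b; exact: ltW.
apply/x0/is_edge_edge => //.
  by case/lastP: (s) => // ? ?; rewrite map_rcons last_rcons.
case/lastP: (s) => [|s' j] /=; rewrite ?map_rcons ?last_rcons.
  by have := ltn_ord i; lia.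
by have := ltn_ord j; lia.
Qed.

End paths.

(** * Counting edges between disjoint sets, Borel-Cantelli and a decay estimate *)

(** Two pairs with the same unordered edge are equal or swapped, and a swap would put a vertex in
    both [A] and [B]. *)
Lemma edge_inj_disjoint (V : finType) (f : V -> nat) (A B : {set V}) :
  injective f -> (A :&: B)%SET = finset.set0 ->
  {in finset.setX A B &, injective (fun u => edge (f u.1) (f u.2))}.
Proof.
move=> fI AB [a b] [a' b']; rewrite !finset.in_setX /=.
move=> /andP[aA bB] /andP[a'A b'B].
have ABF z : z \in A -> z \in B -> False.
  move=> zA zB; have : z \in (A :&: B)%SET by rewrite inE zA zB.
  by rewrite AB inE.
rewrite /edge => -[emin emax].
have [[/fI -> /fI ->//]|[/fI ab /fI ba]] :
    (f a = f a' /\ f b = f b') \/ (f a = f b' /\ f b = f a') by lia.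
by case: (ABF b'); rewrite // -ab.
Qed.

Section borel_cantelli.
Context {d : measure_display} {T : measurableType d} {R : realType}.
Variable P : probability T R.

Lemma ae_eventually_not (F : (set T)^nat) (N : nat) :
  (forall n, measurable (F n)) ->
  (forall n, (N <= n)%N -> (P (F n) <= (2^-n)%:E)%E) ->
  {ae P, forall t, \forall n \near \oo, ~ F n t}.
Proof.
move=> mF PF; pose G n := F (n + N.+1)%N.
have mG n : measurable (G n) by exact: mF.
have PG : P (lim_sup_set G) = 0%E.
  apply: lim_sup_set_cvg0 => //.
  apply: (@le_lt_trans _ _ (\sum_(n <oo) (1 / (2 ^ (n + 1))%:R)%:E)%E).
    apply: lee_nneseries => n _ //; rewrite (le_trans (PF _ _))//; first by lia.
    rewrite lee_fin div1r natrX lef_pV2 ?posrE ?exprn_gt0//.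
    by rewrite ler_weXn2l ?ler1n//; lia.
  have /cvg_lim -> // := @cvg_geometric_eseries_half R 1 0.
  by rewrite ltry.
exists (lim_sup_set G); split => //.
  by apply: bigcap_measurable => // n _; exact: bigcup_measurable.
move=> t /= notnear n _; apply: contrapT => notG; apply: notnear.
exists (n + N.+1)%N => // j /= nj Fj; apply: notG.
by exists (j - N.+1)%N => /=; [lia|rewrite /G subnK//; lia].
Qed.

Lemma measure_bigcup_fin_le (I : finType) (D : {pred I}) (F : I -> set T)
    (b : R) :
  0 <= b ->
  (forall i, D i -> measurable (F i) /\ (P (F i) <= b%:E)%E) ->
  measurable (\big[setU/set0]_(i | D i) F i) /\
  (P (\big[setU/set0]_(i | D i) F i) <= (#|I|%:R * b)%:E)%E.
Proof.
move=> b0 DF.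
suff [mF PF] : measurable (\big[setU/set0]_(i | D i) F i) /\
    (P (\big[setU/set0]_(i | D i) F i) <= (\sum_(i | D i) b)%:E)%E.
  split => //; apply: le_trans PF _.
  rewrite lee_fin big_const iter_addr_0 -(mulr_natl b).
  by rewrite ler_wpM2r// ler_nat max_card.
elim/big_rec2 : _ => [|i y s /DF[mFi PFi] [ms Ps]].
  by split=> //; rewrite measure0.
split; first exact: measurableU.
by rewrite (le_trans (measureU2 _ _ _))// EFinD leeD.
Qed.

End borel_cantelli.

(** The exponent of [q] is quadratic in [m], so it beats [4 ^ m], the number of pairs of vertex
    sets, and leaves a summable bound. *)
Lemma geometric_square_decay (R : realType) (q : R) (r : nat) :
  0 <= q < 1 -> (0 < r)%N ->
  exists N, forall m, (N <= m)%N ->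
    4 ^+ m * q ^+ ((m %/ r) * (m %/ r)) <= 2 ^- m.
Proof.
move=> /andP[q0 q1] r0.
have [K _ HK] : \forall k \near \oo, q ^+ k < (8 ^+ (2 * r))^-1.
  have /cvgr0_norm_lt : (q ^+ n) @[n --> \oo] --> (0 : R).
    by apply: cvg_expr; rewrite ger0_norm.
  have e0 : 0 < (8 ^+ (2 * r))^-1 :> R by rewrite invr_gt0 exprn_gt0.
  by move/(_ _ e0); apply: filterS => n; apply: le_lt_trans; exact: ler_norm.
(* This threshold gives [k > K], and [k >= 1] turns [m < r * (k + 1)] into [m <= 2 * r * k]. *)
exists (r * K.+1)%N => m rKm; set k := (m %/ r)%N.
have Kk : (K.+1 <= k)%N by rewrite leq_divRL// mulnC.
have mk : (m <= 2 * r * k)%N.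
  have := divn_eq m r; have := ltn_pmod m r0; rewrite -/k; nia.
(* 8 ^ m * q ^ (k ^ 2) <= (8 ^ (2 r) * q ^ k) ^ k since m <= 2 r k. *)
rewrite -[leRHS]mul1r ler_pdivlMr ?exprn_gt0//.
rewrite mulrAC -exprMn (_ : 4 * 2 = 8); last by rewrite -natrM.
rewrite exprM.
apply: (@le_trans _ _ ((8 ^+ (2 * r)) ^+ k * (q ^+ k) ^+ k)).
  by rewrite ler_wpM2r ?exprn_ge0// -exprM ler_weXn2l// ler1n.
rewrite -exprMn exprn_ile1 ?mulr_ge0 ?exprn_ge0//.
by rewrite mulrC -ler_pdivlMr ?exprn_gt0// div1r ltW// HK//=; exact: ltnW.
Qed.

(** * Almost sure lower bound for the last passage time *)

Section lower_bound.
Context {d : measure_display} {T : measurableType d} {R : realType}.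
Variables (P : probability T R) (X : nat * nat -> {RV P >-> R}).
Hypotheses (Xpos : forall e, is_edge e -> {ae P, forall t, 0 < X e t})
  (Xindep : mutually_independent [set e | is_edge e] X)
  (Xident : identically_distributed [set e | is_edge e] X).

(** The probability that an edge is not good; by [Xident] the edge (1, 2) represents all edges. *)
Let q (c : R) := fine (P (X (1, 2)%N @^-1` `]-oo, c])).

Lemma measurable_preimage_le e c : measurable (X e @^-1` `]-oo, c]).
Proof. by rewrite -[X in measurable X]setTI; exact: measurable_funP. Qed.

Lemma probability_edge_le e c : is_edge e ->
  P (X e @^-1` `]-oo, c]) = (q c)%:E.
Proof.
move=> ee; rewrite /q fineK; last first.
  by apply: fin_num_measure; exact: measurable_preimage_le.
exact: (Xident (j := (1, 2)%N) ee).
Qed.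

(** Disjointness makes the [#|A| * #|B|] edges between the two sets distinct, so independence
    applies to them as a finite set [J] of indices. *)
Lemma probability_sparse_pair c m (A B : {set 'I_m}) :
  (A :&: B)%SET = finset.set0 ->
  let E := [set t | forall a b, a \in A -> b \in B ->
                      X (edge a.+2 b.+2) t <= c] in
  measurable E /\ P E = (q c ^+ (#|A| * #|B|))%:E.
Proof.
move=> AB E.
pose s := [seq edge u.1.+2 u.2.+2 |
  u : ('I_m * 'I_m)%type <- enum (finset.setX A B)].
pose J := [fset e in s]%fset.
have us : uniq s.
  rewrite map_inj_in_uniq ?enum_uniq// => u v; rewrite !mem_enum.
  apply: (@edge_inj_disjoint _ (fun i : 'I_m => i.+2)) => // i j [].
  exact: val_inj.
have Jedge e : e \in J -> is_edge e.
  rewrite inE /= => /mapP[[a b]].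
  rewrite mem_enum finset.in_setX /= => /andP[aA bB] ->.
  apply: is_edge_edge => //; apply/eqP => -[/val_inj ab].
  by have : a \in (A :&: B)%SET; [rewrite inE aA ab|rewrite AB inE].
have EJ : E = \bigcap_(e in [set` J]) (X e @^-1` `]-oo, c]).
  apply/seteqP; split => t /= Et.
    move=> e /=; rewrite inE /= => /mapP[[a b]].
    rewrite mem_enum finset.in_setX /= => /andP[aA bB] ->.
    by rewrite in_itv /=; exact: Et.
  move=> a b aA bB; have := Et (edge a.+2 b.+2); rewrite /= in_itv /=; apply.
  rewrite inE; apply/mapP; exists (a, b) => //.
  by rewrite mem_enum finset.in_setX /= aA.
split.
  rewrite EJ; apply: fin_bigcap_measurable => // e _.
  exact: measurable_preimage_le.
rewrite EJ (Xindep (A := fun=> `]-oo, c]%classic)) => //.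
rewrite big_seq (eq_bigr (fun=> (q c)%:E)); last first.
  by move=> e /Jedge; exact: probability_edge_le.
rewrite -big_seq prodEFin big_const_seq count_predT iter_mulr_1.
by rewrite card_fseq undup_id // size_map -cardE cardsX.
Qed.

Lemma ae_no_sparse_pair (c : R) (r : nat) : q c < 1 -> (0 < r)%N ->
  {ae P, forall t, \forall m \near \oo, forall A B : {set 'I_m},
    (A :&: B)%SET = finset.set0 ->
    (m %/ r <= #|A|)%N -> (m %/ r <= #|B|)%N ->
    exists a b : 'I_m, [/\ a \in A, b \in B & c < X (edge a.+2 b.+2) t]}.
Proof.
move=> q1 r0.
have q0 : 0 <= q c by rewrite fine_ge0.
pose E m (u : {set 'I_m} * {set 'I_m}) := [set t | forall a b,
  a \in u.1 -> b \in u.2 -> X (edge a.+2 b.+2) t <= c].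
pose D m : {pred {set 'I_m} * {set 'I_m}} := fun u =>
  [&& (u.1 :&: u.2 == finset.set0)%SET, (m %/ r <= #|u.1|)%N
    & (m %/ r <= #|u.2|)%N].
(* The event that some large disjoint pair has no good edge: a union over at most
   [2 ^ m * 2 ^ m = 4 ^ m] pairs, each of probability at most [q c ^+ ((m %/ r) * (m %/ r))]. *)
pose F m := \big[setU/set0]_(u | D m u) E m u.
have mPF m : measurable (F m) /\
    (P (F m) <= (4 ^+ m * q c ^+ ((m %/ r) * (m %/ r)))%:E)%E.
  have -> : 4 ^+ m = (#|{: {set 'I_m} * {set 'I_m}}|)%:R :> R.
    have -> : #|{: {set 'I_m} * {set 'I_m}}| = (2 ^ m * 2 ^ m)%N.
      by rewrite card_prod -cardsT -powersetT card_powerset cardsT card_ord.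
    by rewrite -expnMn natrX.
  apply: measure_bigcup_fin_le; first by rewrite exprn_ge0.
  move=> [A B] /and3P[/eqP /= AB kA kB].
  have [mE ->] := probability_sparse_pair c AB; split => //.
  by rewrite lee_fin ler_wiXn2l ?leq_mul// ltW.
have [|N HN] := @geometric_square_decay R (q c) r _ r0; first by rewrite q0.
have := @ae_eventually_not _ _ _ P F N (fun m => (mPF m).1).
have PF m : (N <= m)%N -> (P (F m) <= (2 ^- m)%:E)%E.
  by move=> Nm; rewrite (le_trans (mPF m).2)// lee_fin HN.
move=> /(_ PF); apply: filterS => t; apply: filterS => m notF A B AB kA kB.
apply: contrapT => noab; apply: notF.
rewrite /F (bigD1 (A, B)) /=; last by rewrite /D /= AB eqxx kA kB.
left => a b /= aA bB; rewrite leNgt; apply/negP => cab.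
by apply: noab; exists a, b.
Qed.

(** There are countably many edges, so the exceptional null sets can be united along the enumeration
    [unpickle]. *)
Lemma ae_forall_edge (Q : nat * nat -> T -> Prop) :
  (forall e, is_edge e -> {ae P, forall t, Q e t}) ->
  {ae P, forall t, forall e, is_edge e -> Q e t}.
Proof.
move=> aeQ.
have /ae_foralln : forall n, {ae P, forall t, forall e : nat * nat,
    choice.unpickle n = Some e -> is_edge e -> Q e t}.
  move=> n; case: (choice.unpickle n) => [e|]; last exact: aeW.
  have [ee|ne] := boolP (is_edge e).
    by apply: filterS (aeQ e ee) => t Qt _ [<-].
  by apply: aeW => t _ [<-]; rewrite (negbTE ne).
apply: filterS => t Qt e; apply: (Qt (choice.pickle e)).
by rewrite choice.pickleK.
Qed.

Lemma ae_last_passage_time_ge (c : R) (r : nat) :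
  0 <= c -> q c < 1 -> (0 < r)%N ->
  {ae P, forall t, \forall m \near \oo,
    c * (m%:R - (2 * (m %/ r))%:R - 1) <=
      last_passage_time (fun e => X e t) m.+2}.
Proof.
move=> c0 q1 r0; move: (ae_no_sparse_pair q1 r0) (ae_forall_edge Xpos).
apply: filterS2 => t nosparse Xt0; apply: filterS nosparse => m.
apply: last_passage_time_ge => //.
by move=> e /Xt0/ltW.
Qed.

Lemma ae_last_passage_time_div_ge (a c : R) :
  0 <= c -> a < c -> q c < 1 ->
  {ae P, forall t, \forall n \near \oo,
    a <= last_passage_time (fun e => X e t) n / n%:R}.
Proof.
move=> c0 ac q1.
pose r := (Num.truncn (4 * c / (c - a))).+1.
have rc : 4 * c / (c - a) < r%:R by exact: truncnS_gt.
have := ae_last_passage_time_ge c0 q1 (ltn0Sn _ : (0 < r)%N).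
apply: filterS => t [N _ HN].
(* For [m >= N'] the other half of the surplus covers [c + 2 * a], the cost of the [- 1] and of
   [n = m + 2]. *)
pose N' := (Num.truncn (2 * (`|a| * 2 + c) / (c - a))).+1.
exists (maxn N N').+2 => // n /=; case: n => [//|[//|m]] Nm.
have {Nm} : (maxn N N' <= m)%N by lia.
rewrite geq_max => /andP[Nm N'm].
rewrite ler_pdivlMr ?ltr0n//; apply: le_trans (HN m Nm).
have ca0 : 0 < c - a by rewrite subr_gt0.
have h1 : 4 * c < r%:R * (c - a) by rewrite -ltr_pdivrMr.
have h2 : 2 * (`|a| * 2 + c) < m%:R * (c - a).
  rewrite -ltr_pdivrMr//; apply: (lt_le_trans (truncnS_gt _)).
  by rewrite ler_nat.
have h3 : (m %/ r)%:R * r%:R <= m%:R :> R by rewrite -natrM ler_nat leq_divM.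
have h4 : (m %/ r)%:R * (4 * c) <= m%:R * (c - a).
  apply: (@le_trans _ _ ((m %/ r)%:R * (r%:R * (c - a)))).
    by rewrite ler_wpM2l// ltW.
  by rewrite mulrA ler_wpM2r// ltW.
have -> : m.+2%:R = m%:R + 2 :> R by rewrite -addn2 natrD.
rewrite natrM; have := ler_norm a.
by move: (m%:R) ((m %/ r)%:R) (`|a|) h2 h4 => M k na h2 h4 h5; lra.
Qed.

End lower_bound.

(** * The essential supremum of a passage time *)

Section essential_supremum.
Context {d : measure_display} {T : measurableType d} {R : realType}.
Variable P : probability T R.

(** [ess_sup] is an infimum over extended real levels. Real levels suffice: [+oo] bounds trivially,
    and [-oo] is exceeded with probability one. *)
Lemma ess_sup_EFin (Y : {RV P >-> R}) :
  ess_sup P (EFin \o Y) =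
  ereal_inf [set x%:E | x in [set x : R | P [set t | x < Y t] = 0%E]].
Proof.
have preE x : (EFin \o Y) @^-1` `]x%:E, +oo[ = [set t | x < Y t].
  by apply/seteqP; split => t /=; rewrite in_itv /= andbT lte_fin.
rewrite ess_supEmu0; last exact/measurable_EFinP.
apply/eqP; rewrite eq_le; apply/andP; split.
  apply: ereal_inf_le_tmp => _ [x /= Px <-] /=.
  by rewrite preE.
apply: le_ereal_inf_tmp => -[y|_|] /=; last first.
- rewrite (_ : _ @^-1` _ = setT) ?probability_setT; last first.
    by apply/seteqP; split => t //= _; rewrite in_itv /= andbT ltNyr.
  by move=> /eqP; rewrite onee_eq0.
- by rewrite leey.
- by rewrite preE => Py; apply: ereal_inf_lbound; exists y.
Qed.

(** The infimum formula involves only the tails [P (Y > x)], which the law determines. *)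
Lemma ess_sup_identically_distributed (Y Z : {RV P >-> R}) :
  (forall A : set R, measurable A -> distribution P Y A = distribution P Z A) ->
  ess_sup P (EFin \o Y) = ess_sup P (EFin \o Z).
Proof.
move=> YZ; rewrite !ess_sup_EFin; congr ereal_inf; congr image.
apply/seteqP; suff YZx x : P [set t | x < Y t] = P [set t | x < Z t].
  by split => x /=; rewrite YZx.
have := YZ _ (measurable_itv `]x, +oo[).
rewrite /distribution /pushforward.
have preE (V : {RV P >-> R}) : V @^-1` `]x, +oo[ = [set t | x < V t].
  by apply/seteqP; split => t /=; rewrite in_itv /= andbT.
by rewrite !preE.
Qed.

Lemma ess_sup_gt0 (Y : {RV P >-> R}) :
  {ae P, forall t, 0 < Y t} -> (0 < ess_sup P (EFin \o Y))%E.
Proof.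
move=> Y0; rewrite ltNge; apply/negP => /ess_supP Yle0.
(* The whole space has positive measure, so the almost-everywhere filter is proper and cannot
   contain a contradiction. *)
have P0 : (0 < P [set: T])%E by rewrite probability_setT lte01.
have PF := ae_properfilter_algebraOfSetsType P0.
have : \forall t \ae P, False.
  by move: Y0 Yle0; apply: filterS2 => t; rewrite /= lee_fin ltNge => /negP.
by move=> /filter_ex[].
Qed.

Lemma probability_le_lt1 (Y : {RV P >-> R}) (c : R) :
  (c%:E < ess_sup P (EFin \o Y))%E -> fine (P (Y @^-1` `]-oo, c])) < 1.
Proof.
rewrite !ltNge; apply: contra => Pc; apply/ess_supP.
have mY : measurable (Y @^-1` `]-oo, c]).
  by rewrite -[X in measurable X]setTI; exact: measurable_funP.
have Pc1 : P (Y @^-1` `]-oo, c]) = 1%E.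
  apply/eqP; rewrite eq_le probability_le1//= -(fineK (fin_num_measure P _ mY)).
  by rewrite lee_fin.
exists (~` (Y @^-1` `]-oo, c])); split; first exact: measurableC.
  by rewrite [LHS](probability_setC P mY) Pc1 subee.
by move=> t /= ; rewrite in_itv /= lee_fin.
Qed.

End essential_supremum.

(** * Measurability, L1 convergence and limits in the extended reals *)

(** For [n > 0] the supremum exceeds [y] exactly when some path does, so preimages of open rays are
    countable unions over vertex lists. For [n = 0] there is no path and the value is constant. *)
Lemma measurable_last_passage_time {d : measure_display} {T : measurableType d}
    {R : realType} (X : nat * nat -> T -> R) (n : nat) :
  (forall e, measurable_fun setT (X e)) ->
  measurable_fun setT (fun t => last_passage_time (fun e => X e t) n).
Proof.
move=> mX; case: n => [|n].
  under eq_fun do rewrite last_passage_time0.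
  exact: measurable_cst.
have mpt p : measurable_fun setT (fun t => passage_time (fun e => X e t) p).
  by apply: measurable_sum => e; exact: mX.
apply: (measurability (@RGenOInfty.G R)) => [|_ [_ [y ->] <-]].
  exact: RGenOInfty.measurableE.
rewrite setTI.
rewrite (_ : _ @^-1` _ = \bigcup_p [set t | self_avoiding_path n.+1 p /\
    y < passage_time (fun e => X e t) p]); last first.
  apply/seteqP; split => t /=; rewrite in_itv /= andbT.
    move=> /sup_gt[]; last by move=> _ [p sap <-] yp; exists p.
    by apply: image_nonempty; exact: self_avoiding_path_nonempty.
  by move=> [p _ [sap yp]]; exact: lt_le_trans (le_last_passage_time _ sap).
apply: countable_bigcupT_measurable => // p.
have [sap|nsap] := pselect (self_avoiding_path n.+1 p); last first.
  by rewrite (_ : [set _ | _] = set0)//; apply/seteqP; split => t // -[].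
rewrite (_ : [set _ | _] = [set t | y < passage_time (fun e => X e t) p]).
  have := mpt p measurableT _ (measurable_itv `]y, +oo[).
  rewrite setTI; congr measurable; apply/seteqP.
  by split => t /=; rewrite in_itv /= andbT.
by apply/seteqP; split => t //= [].
Qed.

Lemma converges_in_L1_bounded {d : measure_display} {T : measurableType d}
    {R : realType} (P : probability T R) (f : nat -> T -> R) (l M : R) :
  (forall n, measurable_fun setT (f n)) ->
  {ae P, forall t n, `|f n t| <= M} ->
  {ae P, forall t, f n t @[n --> \oo] --> l} ->
  converges_in_L1 P f (cst l).
Proof.
move=> mf fM fl.
have icst (r : R) : P.-integrable setT (EFin \o cst r).
  exact: finite_measure_integrable_cst.
have [_ cvg0 _] : [/\ P.-integrable setT (cst l%:E),
    (\int[P]_(t in setT) `|(f n t)%:E - cst l%:E t|)%E @[n --> \oo] --> 0%E &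
    (\int[P]_(t in setT) (f n t)%:E)%E @[n --> \oo] -->
      (\int[P]_(t in setT) cst l%:E t)%E].
  apply: (@dominated_convergence _ _ _ P setT measurableT
    (fun n t => (f n t)%:E) (cst l%:E) (cst M%:E)) => //.
  - by move=> n; exact/measurable_EFinP.
  - by apply: filterS fl => t ft _; apply: cvg_EFin => //; exact: nearW.
  - exact: icst.
  - by apply: filterS fM => t ft n _; rewrite lee_fin.
split.
- move=> n; apply/Lfun1_integrable/integrableP.
  split; first exact/measurable_EFinP.
  have /integrableP[_] := icst `|M|; apply: le_lt_trans.
  apply: ae_ge0_le_integral => //.
  - by apply/measurableT_comp => //; exact/measurable_EFinP.
  - by apply: measurableT_comp => //; exact/measurable_EFinP.
  - apply: filterS fM => t ft _ /=.
    by rewrite normr_id lee_fin (le_trans (ft n))// ler_norm.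
- exact/Lfun1_integrable.
- apply: cvg_trans cvg0; apply: near_eq_cvg; apply: nearW => n.
  by rewrite Lnorm1.
Qed.

(** The lower levels form a sequence tending to [l], so that almost sure bounds at each level hold
    simultaneously. *)
Lemma ereal_cvg_of_bounds (R : realType) (u : nat -> R) (l : \bar R) :
  (0 < l)%E ->
  (forall k : nat, \forall n \near \oo,
     (if l is r%:E then r - k.+1%:R^-1 else k%:R) <= u n) ->
  (forall n, (u n)%:E <= l)%E ->
  (fun n => (u n)%:E) @ \oo --> l.
Proof.
case: l => [r||] // _ lbd ubd.
  apply: cvg_EFin; first exact: nearW.
  apply/cvgrPdist_le => /= eps eps0.
  have [k _ Hk] := near_infty_natSinv_lt (PosNum eps0).
  have {Hk} keps : k.+1%:R^-1 < eps by exact: (Hk k (leqnn k)).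
  apply: filterS (lbd k) => n; have := ubd n; rewrite lee_fin => ur lu.
  rewrite ger0_norm ?subr_ge0// lerBlDr -lerBlDl.
  by apply: le_trans lu; rewrite lerD2l lerN2 ltW.
apply/cvgeyPge => A; apply: filterS (lbd (Num.truncn A).+1) => n.
by rewrite lee_fin; apply: le_trans; rewrite ltW// truncnS_gt.
Qed.

(** The level [c] must also be nonnegative, as the lower bound along a path requires; this matters
    when [a < 0]. *)
Lemma ereal_between (R : realType) (a : R) (l : \bar R) :
  (0 < l)%E -> (a%:E < l)%E -> exists c : R, [/\ 0 <= c, a < c & (c%:E < l)%E].
Proof.
case: l => [r| |]//; rewrite ?lte_fin => r0 ar.
  have [a0|a0] := leP 0 a.
    by exists ((a + r) / 2); split; rewrite ?lte_fin; lra.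
  by exists (r / 2); split; rewrite ?lte_fin; lra.
by exists (`|a| + 1); split; rewrite ?ltry//; have := ler_norm a; lra.
Qed.

(** * Convergence of [W n / n] to the essential supremum *)

Theorem theorem1p1 (R : realType) (d : measure_display) (T : measurableType d)
    (P : probability T R) (X : nat * nat -> {RV P >-> R})
    (Xpos : forall e, is_edge e -> {ae P, forall t, 0 < X e t})
    (Xindep : mutually_independent [set e | is_edge e] X)
    (Xident : identically_distributed [set e | is_edge e] X) :
  let W (n : nat) (t : T) : R := last_passage_time (fun e => X e t) n in
  exists mu : \bar R,
    [/\ (0 < mu)%E,
        {ae P, forall t, (fun n : nat => (W n t / n%:R)%:E) @ \oo --> mu},
        (mu < +oo)%E ->
          converges_in_L1 P (fun n t => W n t / n%:R) (cst (fine mu)),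
        forall e, is_edge e -> mu = ess_sup P (EFin \o X e) &
        forall e, is_edge e ->
          mu = ereal_inf [set x%:E | x in [set x : R |
                 P [set t | x < X e t] = 0%E]]].
Proof.
move=> W; set e1 := (1, 2)%N.
pose mu := ess_sup P (EFin \o X e1).
have mu_ess e : is_edge e -> mu = ess_sup P (EFin \o X e).
  move=> ee; apply: ess_sup_identically_distributed => A mA.
  exact: Xident.
have mu0 : (0 < mu)%E by apply: ess_sup_gt0; exact: Xpos.
have Wlb (a : R) : (a%:E < mu)%E ->
    {ae P, forall t, \forall n \near \oo, a <= W n t / n%:R}.
  move=> amu; have [c [c0 ac cmu]] : exists c : R,
      [/\ 0 <= c, a < c & (c%:E < mu)%E] by exact: ereal_between.
  apply: (ae_last_passage_time_div_ge Xpos Xindep Xident c0 ac).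
  exact: probability_le_lt1.
have X_le_mu : {ae P, forall t, forall e, is_edge e -> ((X e t)%:E <= mu)%E}.
  apply: ae_forall_edge => e /mu_ess ->; exact: ess_sup_ge.
have X_gt0 := ae_forall_edge Xpos.
have Wge0 : {ae P, forall t n, 0 <= W n t / n%:R}.
  apply: filterS X_gt0 => t Xt n; rewrite divr_ge0//.
  by apply: last_passage_time_ge0 => e /Xt/ltW.
have Wub : {ae P, forall t n, ((W n t / n%:R)%:E <= mu)%E}.
  (* At [n = 0] the inverse of zero is zero, so the quotient is 0, which lies below [mu]. *)
  apply: filterS X_le_mu => t Xt [|n]; first by rewrite invr0 mulr0 ltW.
  have := mu0; case muE : mu => [r| |]// r0; last by rewrite leey.
  rewrite lee_fin ler_pdivrMr ?ltr0n//; apply: last_passage_time_le => //.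
    by rewrite -lee_fin ltW.
  by move=> e /Xt; rewrite muE.
have Wcvg : {ae P, forall t, (fun n : nat => (W n t / n%:R)%:E) @ \oo --> mu}.
  have Wlbs : {ae P, forall t (k : nat), \forall n \near \oo,
      (if mu is r%:E then r - k.+1%:R^-1 else k%:R) <= W n t / n%:R}.
    apply/ae_foralln => k; apply: Wlb.
    have := mu0; case: (mu) => [r| |]// _; last by rewrite ltry.
    by rewrite lte_fin ltrBlDr ltrDl invr_gt0.
  move: Wlbs Wub; apply: filterS2 => t lbd ubd.
  exact: ereal_cvg_of_bounds.
exists mu; split => //.
  move=> muoo; have mufin : mu = (fine mu)%:E.
    by rewrite fineK// fin_numElt muoo (lt_trans _ mu0).
  apply: (@converges_in_L1_bounded _ _ _ P _ _ (fine mu)).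
  - move=> n; apply: measurable_funM => //.
    by apply: measurable_last_passage_time.
  - move: Wge0 Wub; apply: filterS2 => t ge0 ub n.
    by rewrite ger0_norm// -lee_fin -mufin.
  - by apply: filterS Wcvg => t; rewrite {1}mufin => /fine_cvg.
by move=> e ee; rewrite (mu_ess e ee) ess_sup_EFin.
Qed.
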